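(* Let $b(n,m)$ denote the number of Arndt compositions of $n$ whose last part equals $m$. Define $t_1(0)=1$, $t_1(1)=0$, $t_1(n)=F_{n-2}$ for $n\ge2$, and $t_2(0)=0$, $t_2(1)=1$, $t_2(n)=F_{n-1}$ for $n\ge 2$, where $F_n$ are the Fibonacci numbers ($F_0=0,F_1=1,F_n=F_{n-1}+F_{n-2}$). Then for all integers $n\ge 1$ and $m\ge 1$, $$b(n,m)=\begin{cases} t_1(n-m), & \text{if } m\leq n <2m,\\ t_1(n-m) + t_2(n-2m), & \text{if } 2m\leq n,\\ 0, & \text{otherwise.} \end{cases}$$
   Context: A composition of $n$ is a finite sequence $(\sigma_1,\dots,\sigma_\ell)$ of positive integers summing to $n$. An Arndt composition is one with $\sigma_{2i-1}>\sigma_{2i}$ for every positive integer $i$ with $2i\le\ell$. The last part of a nonempty composition is $\sigma_\ell$. *)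

(* Defs.v *)
From mathcomp Require Import all_boot.

Set Implicit Arguments.
Unset Strict Implicit.
Unset Printing Implicit Defensive.

Definition is_composition (n : nat) (s : seq nat) : bool :=
  all (fun x => 0 < x) s && (sumn s == n).

(* sigma_i with the usual 1-based indexing; only meaningful for 1 <= i <= size s *)
Definition part (s : seq nat) (i : nat) : nat := nth 0 s i.-1.

Definition is_arndt (s : seq nat) : bool :=
  [forall i : 'I_(size s).+1,
    (0 < i) && (2 * i <= size s) ==> (part s (2 * i - 1) > part s (2 * i))].

(* [last 0 s] is 0 on the empty sequence, so for 0 < m the empty composition
   is never counted *)
Definition is_arndt_last (n m : nat) (s : seq nat) : bool :=
  [&& is_composition n s, is_arndt s & last 0 s == m].

(* Every composition of n has at most n parts, each at most n, so it is
   represented exactly once in the finite type n.-bseq 'I_n.+1: see b_enum *)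
Definition b (n m : nat) : nat :=
  #|[set s : n.-bseq 'I_n.+1 | is_arndt_last n m (map val s)]|.

Fixpoint fib (n : nat) : nat :=
  match n with
  | 0 => 0
  | 1 => 1
  | (n''.+1 as n').+1 => fib n' + fib n''
  end.

Definition t1 (n : nat) : nat :=
  match n with 0 => 1 | 1 => 0 | _ => fib (n - 2) end.

Definition t2 (n : nat) : nat :=
  match n with 0 => 0 | 1 => 1 | _ => fib (n - 1) end.

Lemma is_arndtP (s : seq nat) :
  reflect (forall i, 0 < i -> 2 * i <= size s -> part s (2 * i - 1) > part s (2 * i))
          (is_arndt s).
Proof.
apply: (iffP forallP) => [H i i0 is_ | H i].
  have lt_i : i < (size s).+1.
    by rewrite ltnS (leq_trans _ is_)// mul2n -addnn leq_addr.
  by have /implyP := H (Ordinal lt_i); apply; rewrite /= i0.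
by apply/implyP => /andP[]; apply: H.
Qed.

Lemma composition_bound n s :
  is_composition n s -> (size s <= n) && all (fun x => x < n.+1) s.
Proof.
case/andP=> + /eqP <-; elim: s => //= x s IH /andP[x0 /IH /andP[ss sl]].
rewrite ltnS leq_addr -[(size s).+1]add1n leq_add //=.
by apply: sub_all sl => y; rewrite !ltnS => /leq_trans; apply; apply: leq_addl.
Qed.

Lemma b_enum n m (l : seq (seq nat)) :
  uniq l -> (forall s, (s \in l) = is_arndt_last n m s) -> b n m = size l.
Proof.
move=> ul lE; rewrite /b cardE.
set e := enum _; pose f (s : n.-bseq 'I_n.+1) := map val s.
have fI : injective f by move=> x y /(inj_map val_inj) /val_inj.
rewrite -(size_map f); apply/perm_size/uniq_perm => //.
  by rewrite map_inj_uniq ?enum_uniq.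
move=> s; rewrite lE; apply/mapP/idP => [[x + ->]|Ps].
  by rewrite mem_enum inE.
have /andP[ss sl] : (size s <= n) && all (fun x => x < n.+1) s.
  by apply: composition_bound; case/and3P: Ps.
have ps : size (map (@inord n) s) <= n by rewrite size_map.
have Es : s = f (Bseq ps).
  rewrite /f /= -map_comp -[LHS]map_id; apply/eq_in_map => x xs /=.
  by rewrite inordK //; apply: (allP sl).
by exists (Bseq ps) => //; rewrite mem_enum inE -/(f _) -Es.
Qed.

(* Main.v *)
(** Split an Arndt composition with last part [m] by the parity of its length.
    Odd length: removing [m] leaves an even-length Arndt composition of [n - m].
    Even length: removing the last pair [(a, m)], [a > m], leaves an even-length
    Arndt composition of some [i < n - 2m], and [i] determines [a].
    So it remains to count the even-length Arndt compositions of [k], and to sum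
    the counts.  For [k >= 4] the Fibonacci recurrence is bijective.  If the
    first pair [(a, b)] has [a > b + 1], lower [a] by one; this gives everything
    of weight [k - 1].  If [a = b + 1], the result has weight [k - 2]: lower both
    parts when [b > 1] (giving the compositions with [a = b + 1]), and otherwise
    delete the leading [(2, 1)] and raise the new first part by one (giving those
    with [a > b + 1]). *)
Require Import Defs.
From mathcomp Require Import all_boot zify.

Set Implicit Arguments.
Unset Strict Implicit.
Unset Printing Implicit Defensive.

Lemma seq_pair_ind (T : Type) (P : seq T -> Prop) :
  P [::] -> (forall a, P [:: a]) ->
  (forall a b s, P s -> P [:: a, b & s]) -> forall s, P s.
Proof.
move=> P0 P1 P2 s; suff [] : P s /\ forall a, P (a :: s) by [].
by elim: s => [|b s [Ps Pbs]]; split=> // a; apply: P2.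
Qed.

Fixpoint arndt_rec (s : seq nat) : bool :=
  if s is a :: s1 then
    if s1 is b :: s2 then (b < a) && arndt_rec s2 else true
  else true.

(** Index 1 compares the first pair, and index [i.+1] of [[:: a, b & s]] is index [i] of [s]. The
    index rewrites expose the two successors that let [nth] skip [a] and [b]. *)
Lemma is_arndtE s : is_arndt s = arndt_rec s.
Proof.
elim/seq_pair_ind: s => [|a|a b s IH] /=.
- by apply/is_arndtP => i /=; lia.
- by apply/is_arndtP => i /=; lia.
rewrite -IH; apply/is_arndtP/andP => [H|[ba /is_arndtP H] i i0 /= si].
  split; first exact: (H 1).
  apply/is_arndtP => i i0 si; have := H i.+1 isT.
  rewrite /part (_ : (2 * i.+1 - 1).-1 = (2 * i - 1).-1.+2); last by lia.
  by rewrite (_ : (2 * i.+1).-1 = (2 * i).-1.+2) /=; [apply; lia | lia].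
case: i i0 si => [//|[//|i]] _ si; have := H i.+1 isT.
rewrite /part (_ : (2 * i.+2 - 1).-1 = (2 * i.+1 - 1).-1.+2); last by lia.
by rewrite (_ : (2 * i.+2).-1 = (2 * i.+1).-1.+2) /=; [apply; lia | lia].
Qed.

(** When [s] has even length, no compared pair straddles the junction. *)
Lemma arndt_rec_cat s t :
  ~~ odd (size s) -> arndt_rec (s ++ t) = arndt_rec s && arndt_rec t.
Proof.
elim/seq_pair_ind: s => [//|a //|a b s IH] /=.
by rewrite negbK => /IH ->; rewrite andbA.
Qed.

Definition even_arndt (k : nat) (s : seq nat) : bool :=
  [&& is_composition k s, arndt_rec s & ~~ odd (size s)].

Lemma even_arndt_cons2 k a b s :
  even_arndt k [:: a, b & s] =
  [&& 0 < b, b < a, a + b <= k & even_arndt (k - (a + b)) s].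
Proof.
rewrite /even_arndt /is_composition /= negbK.
by case: all; case: arndt_rec; case: odd => /=; lia.
Qed.

Lemma even_arndt_nil k : even_arndt k [::] = (k == 0).
Proof. by rewrite /even_arndt /is_composition /= andbT eq_sym. Qed.

Lemma even_arndt_seq1 k a : even_arndt k [:: a] = false.
Proof. by rewrite /even_arndt /= !andbF. Qed.

Lemma even_arndt0 s : even_arndt 0 s = (s == [::]).
Proof.
case: s => [|a [|b s]]; rewrite ?even_arndt_nil ?even_arndt_seq1 //.
by rewrite even_arndt_cons2 /=; apply/negP => /and4P[]; lia.
Qed.

Lemma even_arndt_pos k s : 0 < k -> even_arndt k s ->
  exists a b t, [/\ s = [:: a, b & t], 0 < b, b < a, a + b <= k
                  & even_arndt (k - (a + b)) t].
Proof.
move=> k0; case: s => [|a [|b t]]; rewrite ?even_arndt_nil ?even_arndt_seq1 //.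
  by lia.
by rewrite even_arndt_cons2 => /and4P[]; exists a, b, t.
Qed.

Definition incr_head (s : seq nat) : seq nat :=
  if s is a :: t then a.+1 :: t else [::].

(** Inverse of the passage from weight [k] to [k - 2]. On nonempty even-length Arndt compositions
    both branches produce a first pair with difference 1; its second entry, above 1 or equal to 1,
    tells them apart. *)
Definition raise_pair (s : seq nat) : seq nat :=
  if s is [:: a, b & t] then
    if a == b.+1 then [:: a.+1, b.+1 & t] else [:: 2, 1, a.-1, b & t]
  else [::].

(** The recurrence starts only at 4: at weight 3, deleting [(2, 1)] leaves no part to raise. *)
Fixpoint even_arndts (k : nat) : seq (seq nat) :=
  match k with
  | 0 => [:: [::]]
  | k1.+1 => match k1 with
    | 0 | 1 => [::]
    | 2 => [:: [:: 2; 1]]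
    | k2.+1 => map incr_head (even_arndts k1) ++ map raise_pair (even_arndts k2)
    end
  end.

Lemma even_arndtsS k : even_arndts k.+4 =
  map incr_head (even_arndts k.+3) ++ map raise_pair (even_arndts k.+2).
Proof. by []. Qed.

Lemma even_arndts_ind (P : nat -> Prop) :
  P 0 -> P 1 -> P 2 -> P 3 -> (forall k, P k.+2 -> P k.+3 -> P k.+4) ->
  forall k, P k.
Proof.
move=> P0 P1 P2 P3 PS [//|[//|k]].
suff [] : P k.+2 /\ P k.+3 by [].
by elim: k => [|k [? ?]] //; split=> //; apply: PS.
Qed.

Lemma mem_even_arndts k s : (s \in even_arndts k) = even_arndt k s.
Proof.
elim/even_arndts_ind: k s => [||||k IH2 IH3] s.
- by rewrite even_arndt0 inE.
- apply/esym/negP => /even_arndt_pos[//|a [b [t [_]]]]; lia.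
- apply/esym/negP => /even_arndt_pos[//|a [b [t [_]]]]; lia.
- rewrite inE; apply/eqP/idP => [-> //|/even_arndt_pos[//|a [b [t [-> b0 ba abk]]]]].
  have [-> ->] : a = 2 /\ b = 1 by lia.
  by rewrite even_arndt0 => /eqP ->.
rewrite even_arndtsS mem_cat; apply/orP/idP.
  case=> /mapP[u]; rewrite ?IH2 ?IH3.
    move=> /even_arndt_pos[//|a [b [t [-> b0 ba abk Et]]]] ->.
    by rewrite even_arndt_cons2 addSn subSS Et; lia.
  move=> /even_arndt_pos[//|a [b [t [-> b0 ba abk Et]]]] -> /=.
  case: eqP => [_|neq]; rewrite !even_arndt_cons2.
    by rewrite addSn addnS !subSS Et; lia.
  (* Here [a > b + 1], so [a.-1 > b] still holds, and the weight grows by 3 - 1 = 2. *)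
  by rewrite (_ : _ - _ - _ = k.+2 - (a + b)) ?Et; lia.
move=> /even_arndt_pos[//|a [b [t [-> b0 ba abk Et]]]].
have [ab|ab] := ltnP b.+1 a; [left|right]; apply/mapP.
  exists [:: a.-1, b & t]; last by rewrite /= prednK //; lia.
  rewrite IH3 even_arndt_cons2 (_ : _ - _ = k.+4 - (a + b)) ?Et; lia.
have {ba ab} Ea : a = b.+1 by lia.
subst a; have [b1|b1] := ltnP 1 b.
  exists [:: b, b.-1 & t]; last by rewrite /= prednK // eqxx.
  by rewrite IH2 even_arndt_cons2 (_ : _ - _ = k.+4 - (b.+1 + b)) ?Et; lia.
have {b1} Eb : b = 1 by lia.
(* The remaining weight is [k + 1 > 0], so a pair [(c, d)] follows the leading [(2, 1)]. *)
subst b; case/even_arndt_pos: Et => [|c [d [u [-> d0 dc cdk Eu]]]]; first by lia.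
exists [:: c.+1, d & u]; last by rewrite /= eqSS gtn_eqF.
by rewrite IH2 even_arndt_cons2 (_ : _ - _ = k.+4 - (2 + 1) - (c + d)) ?Eu; lia.
Qed.

(** The two images are disjoint: the entries of the first pair differ by at least 2 after
    [incr_head], by exactly 1 after [raise_pair]. *)
Lemma uniq_even_arndts k : uniq (even_arndts k).
Proof.
elim/even_arndts_ind: k => // k U2 U3.
rewrite even_arndtsS cat_uniq !map_inj_in_uniq ?U2 ?U3 ?andbT //.
- apply/hasPn => _ /mapP[u + ->]; rewrite mem_even_arndts.
  move=> /even_arndt_pos[//|a [b [t [-> _ ba _ _]]]].
  apply/mapP => -[v]; rewrite mem_even_arndts.
  move=> /even_arndt_pos[//|c [d [w [-> _ dc _ _]]]] /=.
  by case: eqP => ab [] *; lia.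
- move=> u v; rewrite !mem_even_arndts.
  move=> /even_arndt_pos[//|a [b [t [-> b0 ba _ _]]]].
  move=> /even_arndt_pos[//|c [d [w [-> d0 dc _ _]]]] /=.
  (* In the two mixed cases, equal second entries would force [b = 0] or [d = 0]. *)
  case: eqP => ab; case: eqP => cd [].
  + by move=> -> -> ->.
  + by move=> *; lia.
  + by move=> *; lia.
  + by move=> ac -> ->; congr (_ :: _); lia.
- move=> u v; rewrite !mem_even_arndts.
  move=> /even_arndt_pos[//|a [b [t [-> _ _ _ _]]]].
  by move=> /even_arndt_pos[//|c [d [w [-> _ _ _ _]]]] /= [-> -> ->].
Qed.

Lemma size_even_arndts k : size (even_arndts k) = t1 k.
Proof.
elim/even_arndts_ind: k => // k IH2 IH3.
by rewrite even_arndtsS size_cat !size_map IH2 IH3 /t1 !subSS !subn0.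
Qed.

(** For [k >= 2] the increment of [t2] is F_k - F_{k-1} = F_{k-2}. This evaluates the sum over
    prefix weights in the even-length case. *)
Lemma sum_t1 k : sumn (map t1 (iota 0 k)) = t2 k.
Proof.
elim: k => // k IH; rewrite -addn1 iotaD map_cat sumn_cat IH add0n addn1 /= addn0.
by case: k {IH} => [|[|k]] //; rewrite /t1 /t2 !subSS !subn0.
Qed.

(** Without the guard, [n - m] would truncate to 0 for [n < m] and [[:: m]] would be listed. *)
Definition arndts_odd (n m : nat) : seq (seq nat) :=
  if m <= n then [seq rcons s m | s <- even_arndts (n - m)] else [::].

(** The index [i] is the weight of the prefix; the penultimate part [n - m - i] exceeds [m] exactly
    when [i < n - 2 * m]. *)
Definition arndts_even (n m : nat) : seq (seq nat) :=
  [seq s ++ [:: n - m - i; m] | i <- iota 0 (n - 2 * m), s <- even_arndts i].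

Lemma mem_arndts_odd n m s : 0 < m ->
  (s \in arndts_odd n m) = odd (size s) && is_arndt_last n m s.
Proof.
move=> m0; rewrite /is_arndt_last is_arndtE.
case/lastP: s => [|s a].
  rewrite /arndts_odd; case: ifP => // _; apply/mapP => -[[|? ?]] //.
rewrite last_rcons size_rcons /=.
have -> : (rcons s a \in arndts_odd n m) = [&& a == m, m <= n & even_arndt (n - m) s].
  rewrite /arndts_odd; case: leqP => _; last by rewrite andbF.
  apply/mapP/andP => [[u + /rcons_inj[-> ->]]|[/eqP -> Es]].
    by rewrite mem_even_arndts eqxx.
  by exists s; rewrite ?mem_even_arndts.
rewrite /even_arndt /is_composition -cats1 all_cat sumn_cat /= addn0 andbT.
have [odd_s|even_s] := boolP (odd (size s)); first by rewrite !andbF.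
rewrite arndt_rec_cat //= !andbT.
by case: eqP => [->|]; case: all; case: arndt_rec => /=; lia.
Qed.

Lemma mem_arndts_even n m s : 0 < m ->
  (s \in arndts_even n m) = ~~ odd (size s) && is_arndt_last n m s.
Proof.
move=> m0; rewrite /is_arndt_last is_arndtE.
apply/allpairsPdep/idP => [[i [u [+ + ->]]]|].
  rewrite mem_iota mem_even_arndts => /andP[_ ilt] /and3P[/andP[pos_u /eqP su] au ou].
  rewrite last_cat /= eqxx size_cat addn2 /= negbK ou.
  rewrite /is_composition arndt_rec_cat // au all_cat pos_u sumn_cat su /=.
  by lia.
case/lastP: s => [|s b]; first by rewrite (ltn_eqF m0) !andbF.
case/lastP: s => [|s a]; first by [].
rewrite last_rcons !size_rcons /= negbK => /and4P[even_s + + /eqP Eb].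
rewrite -!cats1 -catA /= {b}Eb /is_composition all_cat sumn_cat /=.
rewrite arndt_rec_cat //= => /andP[/andP[pos_s _] /eqP sn] /andP[as_ ma].
exists (sumn s), s; split.
- by rewrite mem_iota; lia.
- by rewrite mem_even_arndts /even_arndt /is_composition pos_s eqxx as_.
- by congr (_ ++ [:: _; _]); lia.
Qed.

Lemma uniq_arndts_odd n m : uniq (arndts_odd n m).
Proof.
rewrite /arndts_odd; case: ifP => // _.
by rewrite map_inj_uniq ?uniq_even_arndts // => s t /rcons_inj[].
Qed.

Lemma uniq_arndts_even n m : uniq (arndts_even n m).
Proof.
apply: allpairs_uniq_dep => [|i _|]; rewrite ?iota_uniq ?uniq_even_arndts //.
move=> _ _ /allpairsPdep[i [s [+ _ ->]]] /allpairsPdep[j [t [+ _ ->]]] /=.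
rewrite !mem_iota => ilt jlt.
(* In [rcons] form the prefixes and penultimate parts can be compared; the bounds on [i] and [j]
   rule out truncation, so [n - m - i = n - m - j] gives [i = j]. *)
rewrite -[_ :: _]/([:: _] ++ [:: m]) -[X in _ = _ ++ X]/([:: _] ++ [:: m]) !catA !cats1.
by move=> /rcons_inj[/rcons_inj[-> ij]]; congr existT; lia.
Qed.

(** The second term needs no guard: for [n < 2 * m] the subtraction truncates to 0, and
    [t2 0 = 0]. *)
Lemma bE n m : 0 < m ->
  b n m = (if m <= n then t1 (n - m) else 0) + t2 (n - 2 * m).
Proof.
move=> m0; rewrite (b_enum (l := arndts_odd n m ++ arndts_even n m)).
- rewrite size_cat size_allpairs_dep -sum_t1.
  rewrite (eq_map (g := t1)); last exact: size_even_arndts.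
  by rewrite /arndts_odd; case: ifP => // _; rewrite size_map size_even_arndts.
- rewrite cat_uniq uniq_arndts_odd uniq_arndts_even andbT.
  apply/hasPn => s; rewrite mem_arndts_even //.
  by case/andP => /negbTE odd_s _; rewrite mem_arndts_odd // odd_s.
- by move=> s; rewrite mem_cat mem_arndts_odd // mem_arndts_even //; case: odd; rewrite ?orbF.
Qed.

Theorem theorem3p2 (n m : nat) (hn : 1 <= n) (hm : 1 <= m) :
  b n m = if m <= n < 2 * m then t1 (n - m)
          else if 2 * m <= n then t1 (n - m) + t2 (n - 2 * m)
          else 0.
Proof.
rewrite bE //; case: (leqP m n) => mn; case: (leqP (2 * m) n) => mmn //=.
(* By definition [n <= 2 * m] is [n - 2 * m == 0], so [eqP] turns it into a rewrite rule. *)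
- by rewrite (eqP (ltnW mmn)) addn0.
- by lia.
- by rewrite (eqP (ltnW mmn)).
Qed.
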